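(* If $\mathcal Q$ is vertically bounded, then $B=\{0\}\cup B^{ct}$.
   Context: Let $(K,v)$ be a valued field, $\Gamma$ the divisible hull of $vK$, embedded in a divisible ordered abelian group $\Lambda$. Let $\nu\colon K[x]\to\Lambda\cup\{\infty\}$ be a valuation extending $v$ which is well-specified, i.e. it is not the case that simultaneously $\nu^{-1}(\infty)=0$, the value group of $\nu$ modulo $\Gamma$ is torsion, and the residue field of $\nu$ is algebraic over that of $v$. For $s\ge0$ let $\partial_s$ be the $s$-th Hasse–Schmidt derivative, defined by $f(x+y)=\sum_{s\ge0}(\partial_sf)y^s$. For nonconstant $f$ with $\nu(f)<\infty$ the level is $\epsilon_\nu(f)=\max\{(\nu(f)-\nu(\partial_sf))/s: s\ge1\}$; $\epsilon_\nu(a)=-\infty$ for $a\in K$. A monic $Q\in K[x]$ is a key polynomial for $\nu$ if $\epsilon_\nu(f)<\epsilon_\nu(Q)$ whenever $\deg f<\deg Q$. For monic $Q$, each $f$ has a unique $Q$-expansion $f=\sum_{i\ge0}f_{Q,i}Q^i$ with $\deg f_{Q,i}<\deg Q$; set $\nu_Q(f)=\min_i\nu(f_{Q,i}Q^i)$. Fix $m\ge1$ such that the set $\Psi_m$ of key polynomials of degree $m$ for $\nu$ is nonempty and has no element of maximal $\nu$-value. Let $\mathcal Q\subseteq\Psi_m$ be well-ordered by $Q<R\iff\nu(Q)<\nu(R)$ and cofinal in $\Psi_m$ for $\nu$-values; write $\gamma_Q=\nu(Q)$. As in the paper, all values $\nu_Q(f)$ ($f\ne0$) lie in $\Gamma$.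 ''For all $Q$ large enough'' means for all $Q$ in a final segment of $\mathcal Q$; a family indexed by $\mathcal Q$ is ultimately constant if it is constant on a final segment. $f$ is $\mathcal Q$-stable if $\nu_Q(f)=\nu(f)$ for all $Q$ large enough, $\mathcal Q$-unstable otherwise. Assume unstable polynomials exist; limit key polynomials are the monic $\mathcal Q$-unstable polynomials of minimal degree, forming $\mathrm{KP}_\infty(\mathcal Q)$. Fix $F\in\mathrm{KP}_\infty(\mathcal Q)$, $D=\lfloor\deg F/m\rfloor$, $F=\sum_{\ell=0}^DF_{Q,\ell}Q^\ell$, $\beta_{Q,\ell}=\nu(F_{Q,\ell})\in\Gamma\cup\{\infty\}$. Let $\delta^L$ be the smallest initial segment of $\Gamma$ containing $\{\nu_Q(F):Q\in\mathcal Q\}$; write $x>\delta^L$ if $x\in(\Gamma\setminus\delta^L)\cup\{\infty\}$. Let $J$ be the set of $\ell\in\{0,\dots,D\}$ with $\beta_{Q,\ell}+\ell\gamma_Q>\delta^L$ for all $Q$ large enough, $B=\{0,\dots,D\}\setminus J$, and $B^{ct}$ the set of $\ell\in B$ for which $(\beta_{Q,\ell})_{Q}$ is ultimately constant. A cut $\eta=(\eta^L,\eta^R)$ of $\Gamma$ is vertically bounded if for every $x\in\eta^L$ and rational $q>1$ there is $y\in\eta^L$ with $q(y-x)>z-x$ for all $z\in\eta^L$. Let $\gamma_{\mathcal Q}$ be the cut of $\Gamma$ whose lower set is the smallest initial segment containing $\{\gamma_Q:Q\in\mathcal Q\}$; $\mathcal Q$ is vertically bounded if $\gamma_{\mathcal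 Q}$ is. *)

(* Defs.v *)
From HB Require Import structures.
From mathcomp Require Import all_boot all_order all_algebra.

Set Implicit Arguments.
Unset Strict Implicit.
Unset Printing Implicit Defensive.

Import Order.TTheory GRing.Theory.
Local Open Scope ring_scope.

(* The divisible ordered abelian group Lambda is modelled as a Q-vector space
   (the canonical Q-structure of a divisible torsion-free abelian group)
   together with a total order [le] compatible with addition.
   Lambda u {oo} is modelled as [option Lambda], with [None] = oo.        *)

Section Defs.
Variables (K : fieldType) (L : lmodType rat) (le : rel L).

Definition ordered_qspace : Prop :=
  [/\ reflexive le, antisymmetric le, transitive le, total le &
      forall x y z, le x y -> le (x + z) (y + z)].

Definition ltL (x y : L) : bool := le x y && ~~ le y x.

Definition leo (x y : option L) : bool :=
  match x, y with
  | _, None => true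
  | None, Some _ => false
  | Some a, Some b => le a b
  end.
Definition lto (x y : option L) : bool := leo x y && ~~ leo y x.
Definition addo (x y : option L) : option L :=
  match x, y with Some a, Some b => Some (a + b) | _, _ => None end.
Definition scaleo (n : nat) (x : option L) : option L :=
  match x with Some a => Some (a *+ n) | None => None end.
Definition mino (x y : option L) : option L := if leo x y then x else y.

Inductive xlevel := LNeg | LFin of L | LPos.
Definition ltX (x y : xlevel) : bool :=
  match x, y with
  | LNeg, LNeg => false
  | LNeg, _ => true
  | LFin a, LFin b => ltL a b
  | LFin _, LPos => true
  | _, _ => false
  end.
Definition maxX (x y : xlevel) : xlevel := if ltX x y then y else x.

Variable nu : {poly K} -> option L.

(* nu is a valuation on K[x] (possibly with nonzero support); its
   restriction to constants is the valuation v of K. *)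
Definition is_poly_valuation : Prop :=
  [/\ nu 0 = None, nu 1 = Some 0,
      (forall f g, nu (f * g) = addo (nu f) (nu g)) &
      (forall f g, leo (mino (nu f) (nu g)) (nu (f + g)))].

Definition in_vK (x : L) : Prop := exists a : K, a != 0 /\ nu a%:P = Some x.
Definition in_Gamma (x : L) : Prop := exists2 n : nat, (0 < n)%N & in_vK (x *+ n).

Definition support_trivial : Prop := forall f, nu f = None -> f = 0.
Definition valgroup_torsion_mod_Gamma : Prop :=
  forall f c, nu f = Some c -> exists2 n : nat, (0 < n)%N & in_Gamma (c *+ n).
(* every residue class of f/g (nu f >= nu g) is a root of a nonzero
   polynomial over the residue field of v *)
Definition residue_algebraic : Prop :=
  forall f g c, nu g = Some c -> leo (Some c) (nu f) ->
  exists a : seq K,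
    [/\ forall i, leo (Some 0) (nu (a`_i)%:P),
        exists2 i, (i < size a)%N & nu (a`_i)%:P = Some 0 &
        lto (Some (c *+ (size a).-1))
            (nu (\sum_(i < size a) (a`_i)%:P * f ^+ i * g ^+ ((size a).-1 - i)))].
Definition well_specified : Prop :=
  ~ [/\ support_trivial, valgroup_torsion_mod_Gamma & residue_algebraic].

(* Hasse--Schmidt derivatives: partial_s f = nderivn s f *)
Definition level (f : {poly K}) : xlevel :=
  if (size f <= 1)%N then LNeg else
  match nu f with
  | None => LPos  (* level undefined when nu f = oo *)
  | Some c =>
      foldr maxX LNeg
        [seq match nu (nderivn s f) with
             | None => LNeg
             | Some d => LFin ((s%:R : rat)^-1 *: (c - d))
             end | s <- iota 1 (size f).-1]
  end.

Definition key_poly (Q : {poly K}) : Prop :=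
  Q \is monic /\ forall f : {poly K}, (size f < size Q)%N -> ltX (level f) (level Q).

Definition Psi (m : nat) (Q : {poly K}) : Prop := key_poly Q /\ size Q = m.+1.

Definition qcoef (Q f : {poly K}) (i : nat) : {poly K} := (f %/ Q ^+ i) %% Q.
Definition nuQ (Q f : {poly K}) : option L :=
  foldr mino None [seq nu (qcoef Q f i * Q ^+ i) | i <- iota 0 (size f).+1].

Variables (m : nat) (QQ : {poly K} -> Prop).

Definition well_ordered_by_value : Prop :=
  (forall Q R, QQ Q -> QQ R -> nu Q = nu R -> Q = R) /\
  (forall S : {poly K} -> Prop, (forall Q, S Q -> QQ Q) -> (exists Q, S Q) ->
     exists Q, S Q /\ forall R, S R -> leo (nu Q) (nu R)).

Definition cofinal_in_Psi : Prop :=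
  forall P, Psi m P -> exists Q, QQ Q /\ leo (nu P) (nu Q).

Definition eventually (P : {poly K} -> Prop) : Prop :=
  exists Q0, QQ Q0 /\ forall Q, QQ Q -> leo (nu Q0) (nu Q) -> P Q.

Definition stable (f : {poly K}) : Prop := eventually (fun Q => nuQ Q f = nu f).

Definition limit_key_poly (F : {poly K}) : Prop :=
  [/\ F \is monic, ~ stable F & forall g : {poly K}, ~ stable g -> (size F <= size g)%N].

Variable F : {poly K}.

Definition Dexp : nat := ((size F).-1 %/ m)%N.
Definition beta (Q : {poly K}) (l : nat) : option L := nu (qcoef Q F l).

(* lower set of the cut delta *)
Definition deltaL (x : L) : Prop :=
  in_Gamma x /\ exists Q, QQ Q /\ leo (Some x) (nuQ Q F).
Definition above_delta (x : option L) : Prop :=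
  x = None \/ exists y, [/\ x = Some y, in_Gamma y & ~ deltaL y].

Definition inJ (l : nat) : Prop :=
  (l <= Dexp)%N /\
  eventually (fun Q => above_delta (addo (beta Q l) (scaleo l (nu Q)))).
Definition inB (l : nat) : Prop := (l <= Dexp)%N /\ ~ inJ l.
Definition inBct (l : nat) : Prop :=
  inB l /\ exists Q0, QQ Q0 /\
    forall Q, QQ Q -> leo (nu Q0) (nu Q) -> beta Q l = beta Q0 l.

End Defs.

Section Cuts.
Variables (L : lmodType rat) (le : rel L).
(* a cut given by its lower set eta^L (a subset of Gamma) *)
Definition vertically_bounded (etaL : L -> Prop) : Prop :=
  forall x, etaL x -> forall q : rat, 1 < q ->
    exists y, etaL y /\ forall z, etaL z -> ltL le (z - x) (q *: (y - x)).
End Cuts.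

Definition gammaQL (K : fieldType) (L : lmodType rat) (le : rel L)
  (nu : {poly K} -> option L) (QQ : {poly K} -> Prop) (x : L) : Prop :=
  in_Gamma nu x /\ exists Q, QQ Q /\ leo le (Some x) (nu Q).

(* Main.v *)
(** For [eps] in [L], [mu_eps f := min_s (nu (d_s f) + s eps)] is the valuation
    induced by the Gauss valuation of [f (x + y)] in which [y] has value [eps].
    If [Q0] is a key polynomial of level [eps] and [Q] is monic of the same
    degree with [nu Q >= nu Q0], then [mu_eps] is computed termwise on
    [Q]-expansions, [Q] receiving the value [gamma_Q0]: the initial form of a
    [Q]-coefficient ends at [s = 0] and that of [Q] at a fixed [s > 0], so
    nothing cancels.  In particular [nu_Q0 = mu_eps].

    For [0 < l] and [Q0 < R < Q], the coefficient [F_{Q,l}] differs from the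
    remainder modulo [Q] of [G := sum_i C(i,l) F_{R,i} R^(i-l)] by an error of
    value at least [E := nu_R F - l gamma_R + (gamma_R - gamma_Q0)].  As
    [deg G < deg F], [G] is stable, so [nu (G mod Q) = nu G] for large [Q].
    Vertical boundedness lets one choose [R] so close to the cut that
    [nu_Q' F < nu_R F + (gamma_R - gamma_Q0)] for all [Q'].  Hence either
    [nu G < E] and [beta_{Q,l} = nu G] for large [Q], or [beta_{Q,l} >= E] for
    large [Q] and [l] is not in [B].  Finally [0] is in [B], for otherwise [F]
    would be as stable as [F - (F mod R)], a product of two stable
    polynomials. *)

Require Import Defs.
From HB Require Import structures.
From Stdlib Require Import Classical.
From mathcomp Require Import all_boot all_order all_algebra.

Set Implicit Arguments.
Unset Strict Implicit.
Unset Printing Implicit Defensive.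

Import Order.TTheory GRing.Theory.
Local Open Scope ring_scope.

(** * The Leibniz rule for Hasse-Schmidt derivatives *)

Lemma nderivnM (K : fieldType) (f g : {poly K}) (s : nat) :
  (f * g)^`N(s) = \sum_(i < s.+1) f^`N(i) * g^`N(s - i).
Proof.
elim/poly_ind: f s => [|p c IHp] [|s].
- by rewrite big_ord_recl big_ord0 !nderivn0 !mul0r addr0.
- by rewrite mul0r raddf0 big1 // => i _; rewrite raddf0 mul0r.
- by rewrite big_ord_recl big_ord0 !nderivn0 addr0.
have MX (h : {poly K}) n : (h * 'X)^`N(n.+1) = h^`N(n) + h^`N(n.+1) * 'X.
  by rewrite -[h * 'X]addr0 -(polyC0 K) nderivnMXaddC.
(* By [MX], the derivative of order [s.+1] of a product with ['X] involves orders [s] and [s.+1], so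
   the induction hypothesis is applied at both. *)
rewrite mulrDl mulrAC nderivnD MX !IHp mul_polyC nderivnZ.
rewrite [X in _ = X]big_ord_recl [X in _ + X * 'X + _]big_ord_recl /=.
rewrite !nderivn0 !subn0.
have -> : \sum_(i < s.+1) (p * 'X + c%:P)^`N(bump 0 i) * g^`N(s.+1 - bump 0 i)
   = \sum_(i < s.+1) p^`N(i) * g^`N(s - i)
     + (\sum_(i < s.+1) p^`N(i.+1) * g^`N(s - i)) * 'X.
  rewrite mulr_suml -big_split; apply: eq_bigr => i _ /=.
  by rewrite /bump leq0n add1n nderivnMXaddC subSS mulrDl mulrAC.
under [X in _ + (_ + X) * _ + _]eq_bigr => i _ do rewrite /bump leq0n add1n subSS.
rewrite -mul_polyC !mulrDl [p * 'X * _]mulrAC !addrA.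
by rewrite [LHS](ACl (2*4*1*3)).
Qed.

(** * Order arithmetic in the divisible group and with infinity *)

Section OrderedQSpace.
Variables (L : lmodType rat) (le : rel L).
Hypothesis Hle : ordered_qspace le.

Local Notation lt := (ltL le).

(** Values are compared with finite lower bounds only: [None] satisfies every bound, weak or strict,
    so infinity needs no separate treatment in most estimates. *)
Definition geo (w : L) (x : option L) : bool := leo le (Some w) x.
Definition gto (w : L) (x : option L) : bool := lto le (Some w) x.

Lemma leLxx x : le x x. Proof. by case: Hle. Qed.

Lemma leL_anti x y : le x y -> le y x -> x = y.
Proof. by case: Hle => _ anti _ _ _ xy yx; apply: anti; rewrite xy. Qed.

Lemma le_tr y x z : le x y -> le y z -> le x z.
Proof. by case: Hle => _ _ tr _ _; apply: tr. Qed.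

Lemma ltLNge x y : lt x y = ~~ le y x.
Proof.
rewrite /ltL; case yx: (le y x); rewrite ?andbF ?andbT //.
by case: Hle => _ _ _ tot _; have := tot x y; rewrite yx orbF.
Qed.

Lemma lt_le x y : lt x y -> le x y. Proof. by case/andP. Qed.

Lemma leLNgt x y : le x y = ~~ lt y x.
Proof. by rewrite ltLNge negbK. Qed.

Lemma le_D2r z x y : le (x + z) (y + z) = le x y.
Proof.
case: Hle => _ _ _ _ D2; apply/idP/idP => h; last exact: D2.
by rewrite -(addrK z x) -(addrK z y); apply: D2.
Qed.

Lemma lt_D2r z x y : lt (x + z) (y + z) = lt x y.
Proof. by rewrite !ltLNge le_D2r. Qed.

Lemma leD x y z t : le x y -> le z t -> le (x + z) (y + t).
Proof.
move=> xy zt; apply: (@le_tr (y + z)); rewrite ?le_D2r //.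
by rewrite ![y + _]addrC le_D2r.
Qed.

Lemma le_lt_tr y x z : le x y -> lt y z -> lt x z.
Proof. by rewrite !ltLNge => xy; apply: contra => zx; apply: le_tr xy. Qed.

Lemma lt_le_tr y x z : lt x y -> le y z -> lt x z.
Proof. by rewrite !ltLNge => xy yz; apply: contra xy; apply: le_tr. Qed.

Lemma lt_tr y x z : lt x y -> lt y z -> lt x z.
Proof. by move/lt_le; apply: le_lt_tr. Qed.

Lemma ltLxx x : lt x x = false. Proof. by rewrite ltLNge leLxx. Qed.

Lemma lt_leD x y z t : lt x y -> le z t -> lt (x + z) (y + t).
Proof.
move=> xy zt; apply: (@lt_le_tr (y + z)); first by rewrite lt_D2r.
by rewrite ![y + _]addrC le_D2r.
Qed.

Lemma le_subr x y : le x y = le 0 (y - x).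
Proof. by rewrite -(le_D2r (- x)) subrr. Qed.

Lemma le_transfer x y z t : le x y -> t - z = y - x -> le z t.
Proof. by move=> xy e; rewrite le_subr e -le_subr. Qed.

Lemma lt_transfer x y z t : lt x y -> t - z = y - x -> lt z t.
Proof.
rewrite !ltLNge => xy e; apply: contra xy => /le_transfer; apply.
by rewrite -[LHS]opprB -e opprB.
Qed.

Lemma leMn x y n : le x y -> le (x *+ n) (y *+ n).
Proof.
by move=> xy; elim: n => [|n IHn]; rewrite ?mulr0n ?leLxx // !mulrS leD.
Qed.

Lemma le0M x n m : (n <= m)%N -> le 0 x -> le (x *+ n) (x *+ m).
Proof.
move=> /subnKC<- x0; rewrite mulrnDr -[X in le X]addr0 leD ?leLxx //.
by have := leMn (m - n) x0; rewrite mul0rn.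
Qed.

Lemma mulrn_inj (x y : L) n : (0 < n)%N -> x *+ n = y *+ n -> x = y.
Proof.
move=> n0 /(congr1 ( *:%R (n%:R^-1))).
rewrite -!scaler_nat !scalerA mulVf ?scale1r //.
by rewrite Num.Theory.pnatr_eq0 -lt0n.
Qed.

Lemma leMn_inv x y n : (0 < n)%N -> le (x *+ n) (y *+ n) -> le x y.
Proof.
move=> n0 h; rewrite leLNgt; apply/negP => yx.
have e : x *+ n = y *+ n by apply: leL_anti => //; apply: leMn; apply: lt_le.
by move: yx; rewrite (mulrn_inj n0 e) ltLxx.
Qed.

Lemma geoE w x : geo w (Some x) = le w x. Proof. by []. Qed.

Lemma gtoE w x : gto w (Some x) = lt w x. Proof. by []. Qed.

Lemma gtoNle w x : gto w x = ~~ leo le x (Some w).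
Proof. by case: x => [x|] //; exact: ltLNge. Qed.

Lemma gto_geo w x : gto w x -> geo w x. Proof. by case/andP. Qed.

Lemma geo_le w w' x : le w w' -> geo w' x -> geo w x.
Proof. by case: x => //= a; rewrite /geo /=; apply: le_tr. Qed.

Lemma gto_le w w' x : le w w' -> gto w' x -> gto w x.
Proof. by case: x => //= a h; exact: (le_lt_tr h). Qed.

Lemma gto_lt w w' x : lt w w' -> geo w' x -> gto w x.
Proof. by case: x => //= a h; exact: (lt_le_tr h). Qed.

Lemma geo_addo w w' x y : geo w x -> geo w' y -> geo (w + w') (addo x y).
Proof. by case: x y => [x|] [y|] //; exact: leD. Qed.

Lemma gto_addo w w' x y : gto w x -> geo w' y -> gto (w + w') (addo x y).
Proof. by case: x y => [x|] [y|] //; exact: lt_leD. Qed.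

Lemma addoC (x y : option L) : addo x y = addo y x.
Proof. by case: x y => [x|] [y|] //=; rewrite addrC. Qed.

Lemma geo_gto_addo w w' x y : geo w x -> gto w' y -> gto (w + w') (addo x y).
Proof. by move=> wx wy; rewrite addrC addoC gto_addo. Qed.

Lemma eq_geoP w x : (x = Some w) <-> geo w x /\ ~~ gto w x.
Proof.
split=> [->|[]]; first by rewrite gtoNle /geo /= leLxx.
case: x => [x|] //; rewrite /geo /= gtoNle negbK /= => h1 h2.
by rewrite (leL_anti h1 h2).
Qed.

Lemma leo_refl x : leo le x x. Proof. by case: x => //= x; exact: leLxx. Qed.

Lemma leo_tr y x z : leo le x y -> leo le y z -> leo le x z.
Proof. by case: x y z => [x|] [y|] [z|] //=; exact: le_tr. Qed.

Lemma leo_total x y : leo le x y || leo le y x.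
Proof. by case: x y => [x|] [y|] //=; case: Hle. Qed.

Lemma geo_mino w x y : geo w (mino le x y) = geo w x && geo w y.
Proof.
rewrite /mino; case: ifP => h.
  by case wx: (geo w x) => //=; apply/esym; exact: (leo_tr wx h).
have h' : leo le y x by have := leo_total x y; rewrite h.
by case wy: (geo w y); rewrite ?andbF // andbT; apply/esym; exact: (leo_tr wy h').
Qed.

Lemma geo_foldr_mino w (s : seq (option L)) :
  geo w (foldr (mino le) None s) = all (geo w) s.
Proof. by elim: s => //= x s IHs; rewrite geo_mino IHs. Qed.

(** Ties go to the larger index, since the last index of minimum is the one that adds up under
    products. *)
Lemma last_argmin (h : nat -> option L) (N : nat) :
  (exists2 s, (s <= N)%N & h s != None) ->
  exists n w, [/\ (n <= N)%N, h n = Some w,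
    forall s, (s <= N)%N -> geo w (h s) &
    forall s, (n < s <= N)%N -> gto w (h s)].
Proof.
elim: N => [[[]]// _ | N IHN].
  case e: (h 0%N) => [w|] // _; exists 0%N, w; split=> // [[]// _|[]//].
  by rewrite e /geo /= leLxx.
case=> s sN hs.
have [hprev|hprev] := classic (exists2 s, (s <= N)%N & h s != None); last first.
  have none t : (t <= N)%N -> h t = None.
    by move=> tN; case e: (h t) => [w|] //; case: hprev; exists t; rewrite ?e.
  have es : s = N.+1.
    by apply/eqP; move: sN; rewrite leq_eqVlt => /orP[//|/none e]; rewrite e in hs.
  case e: (h N.+1) hs => [w|]; rewrite es ?e // => _; exists N.+1, w; split=> // t.
    by rewrite leq_eqVlt => /orP[/eqP->|/none->//]; rewrite e /geo /= leLxx.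
  by case/andP => /leq_trans h1 /h1; rewrite ltnn.
have [n [w [nN hn ge gt]]] := IHN hprev.
case hle : (leo le (h N.+1) (Some w)).
  case e : (h N.+1) hle => [w'|] //= ww'; exists N.+1, w'; split=> // t.
    rewrite leq_eqVlt => /orP[/eqP->|/ge]; first by rewrite e /geo /= leLxx.
    exact: geo_le.
  by case/andP => /leq_trans h1 /h1; rewrite ltnn.
have gN : gto w (h N.+1) by rewrite gtoNle hle.
exists n, w; split=> // [|t|t]; first exact: leqW.
  by rewrite leq_eqVlt => /orP[/eqP->|/ge//]; exact: gto_geo.
by case/andP=> nt; rewrite leq_eqVlt => /orP[/eqP->//|tN]; apply: gt; rewrite nt.
Qed.

End OrderedQSpace.

(** * Valuations on polynomials and the auxiliary valuations [mu_eps] *)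

Section Valuation.
Variables (K : fieldType) (L : lmodType rat) (le : rel L).
Hypothesis Hle : ordered_qspace le.
Variable nu : {poly K} -> option L.
Hypothesis Hnu : is_poly_valuation le nu.

Local Notation geo := (geo le).
Local Notation gto := (gto le).

Lemma nu0 : nu 0 = None. Proof. by case: Hnu. Qed.

Lemma nu1 : nu 1 = Some 0. Proof. by case: Hnu. Qed.

Lemma nuM f g : nu (f * g) = addo (nu f) (nu g). Proof. by case: Hnu. Qed.

Lemma nuX f c n : nu f = Some c -> nu (f ^+ n) = Some (c *+ n).
Proof.
move=> e; elim: n => [|n IHn]; first by rewrite expr0 nu1.
by rewrite exprS nuM IHn e mulrS.
Qed.

Lemma geo_nuD w f g : geo w (nu f) -> geo w (nu g) -> geo w (nu (f + g)).
Proof.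
case: Hnu => _ _ _ D fw gw.
by apply: (leo_tr Hle) (D f g); rewrite -/(geo w _) geo_mino // fw.
Qed.

Lemma gto_nuD w f g : gto w (nu f) -> gto w (nu g) -> gto w (nu (f + g)).
Proof.
case: Hnu => _ _ _ /(_ f g) + fw gw; rewrite gtoNle // => D; apply/negP => h.
have := leo_tr Hle D h; rewrite /mino; case: ifP => _; apply/negP;
  by rewrite -gtoNle.
Qed.

Lemma nuN f : nu (- f) = nu f.
Proof.
suff e : nu (-1) = Some 0.
  by rewrite -mulN1r nuM e; case: (nu f) => //= a; rewrite add0r.
have := nuM (-1) (-1); rewrite mulrNN mulr1 nu1.
case: (nu (-1)) => //= a [] e; congr Some.
by apply: (@mulrn_inj _ _ _ 2) => //; rewrite mul0rn mulr2n -e.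
Qed.

Lemma geo_nuB w f g : geo w (nu f) -> geo w (nu g) -> geo w (nu (f - g)).
Proof. by move=> fw gw; apply: geo_nuD; rewrite ?nuN. Qed.

Lemma geo_nu_sum w I (r : seq I) (P : pred I) (E : I -> {poly K}) :
  (forall i, P i -> geo w (nu (E i))) -> geo w (nu (\sum_(i <- r | P i) E i)).
Proof.
move=> h; elim/big_ind: _ => //; first by rewrite nu0.
by move=> x y; exact: geo_nuD.
Qed.

Lemma gto_nu_sum w I (r : seq I) (P : pred I) (E : I -> {poly K}) :
  (forall i, P i -> gto w (nu (E i))) -> gto w (nu (\sum_(i <- r | P i) E i)).
Proof.
move=> h; elim/big_ind: _ => //; first by rewrite nu0.
by move=> x y; exact: gto_nuD.
Qed.

Lemma geo_nuMn w f n : geo w (nu f) -> geo w (nu (f *+ n)).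
Proof. by move=> h; rewrite -(card_ord n) -sumr_const; apply: geo_nu_sum. Qed.

Lemma nuD_eq w f g : nu f = Some w -> gto w (nu g) -> nu (f + g) = Some w.
Proof.
move=> /(eq_geoP Hle)[fw nfw] gw; apply/(eq_geoP Hle); split.
  by apply: geo_nuD => //; apply: gto_geo.
apply: contra nfw => h; rewrite -(addrK g f).
by apply: gto_nuD; rewrite ?nuN.
Qed.

Lemma nuC_finite (a : K) : a != 0 -> exists x, nu a%:P = Some x.
Proof.
move=> a0; have := nuM a%:P a^-1%:P; rewrite -polyCM divff // nu1.
by case: (nu a%:P) => [x|] //; exists x.
Qed.

(* [mu_ge eps f w] says [w <= mu_eps f], and [mu_lead eps f w n] that
   [mu_eps f = w], the minimum being attained for the last time at [n]. *)
Definition mu_term (eps : L) (f : {poly K}) (s : nat) : option L :=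
  addo (nu f^`N(s)) (Some (eps *+ s)).

Definition mu_ge (eps : L) (f : {poly K}) (w : L) : Prop :=
  forall s, geo w (mu_term eps f s).

Definition mu_lead (eps : L) (f : {poly K}) (w : L) (n : nat) : Prop :=
  [/\ mu_ge eps f w, mu_term eps f n = Some w &
      forall s, (n < s)%N -> gto w (mu_term eps f s)].

Lemma geo_shift w c x : geo w (addo x (Some c)) = geo (w - c) x.
Proof. by case: x => [x|] //=; rewrite !geoE -[in RHS](le_D2r Hle c) subrK. Qed.

Lemma gto_shift w c x : gto w (addo x (Some c)) = gto (w - c) x.
Proof. by case: x => [x|] //=; rewrite !gtoE -[in RHS](lt_D2r Hle c) subrK. Qed.

Lemma mu_term0 eps f : mu_term eps f 0 = nu f.
Proof. by rewrite /mu_term nderivn0 mulr0n; case: (nu f) => //= a; rewrite addr0. Qed.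

Lemma mu_ge_nu eps f w : mu_ge eps f w -> geo w (nu f).
Proof. by move/(_ 0%N); rewrite mu_term0. Qed.

Lemma mu_ge_le eps f w w' : le w w' -> mu_ge eps f w' -> mu_ge eps f w.
Proof. by move=> h h' s; apply: geo_le (h' s). Qed.

Lemma mu_geD eps f g w : mu_ge eps f w -> mu_ge eps g w -> mu_ge eps (f + g) w.
Proof.
move=> fw gw s; have := gw s; have := fw s.
by rewrite /mu_term !geo_shift nderivnD; apply: geo_nuD.
Qed.

Lemma mu_geN eps f w : mu_ge eps f w -> mu_ge eps (- f) w.
Proof. by move=> h s; rewrite /mu_term nderivnN nuN; apply: h. Qed.

Lemma mu_geB eps f g w : mu_ge eps f w -> mu_ge eps g w -> mu_ge eps (f - g) w.
Proof. by move=> fw gw; apply: mu_geD => //; apply: mu_geN. Qed.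

Lemma mu_ge0 eps w : mu_ge eps 0 w.
Proof. by move=> s; rewrite /mu_term raddf0 nu0. Qed.

Lemma mu_termM eps f g i s : (i <= s)%N ->
  addo (nu (f^`N(i) * g^`N(s - i))) (Some (eps *+ s)) =
  addo (mu_term eps f i) (mu_term eps g (s - i)).
Proof.
move=> /subnKC {2}<-; rewrite nuM mulrnDr /mu_term.
by case: (nu _) (nu _) => [x|] [y|] //=; rewrite addrACA.
Qed.

Lemma mu_geM eps f g w w' :
  mu_ge eps f w -> mu_ge eps g w' -> mu_ge eps (f * g) (w + w').
Proof.
move=> fw gw s; rewrite /mu_term geo_shift nderivnM; apply: geo_nu_sum => i _.
rewrite -(geo_shift _ (eps *+ s)) mu_termM -1?ltnS //.
exact: geo_addo.
Qed.

Lemma mu_ge_exp eps f w n : mu_ge eps f w -> mu_ge eps (f ^+ n) (w *+ n).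
Proof.
move=> h; elim: n => [|n IHn]; last by rewrite exprS mulrS; apply: mu_geM.
case=> [|s]; first by rewrite mu_term0 expr0 nu1 geoE (leLxx Hle).
by rewrite /mu_term expr0 -[1]/(1%:P) nderivnC nu0.
Qed.

(** In the Leibniz sum of order [n + n'], every term but the one at [i = n] has a factor beyond its
    last minimal index and so lies strictly above [w + w']. For higher orders this holds for all
    terms. *)
Lemma mu_leadM eps f g w w' n n' : mu_lead eps f w n -> mu_lead eps g w' n' ->
  mu_lead eps (f * g) (w + w') (n + n').
Proof.
case=> fw fn fgt [gw gn ggt]; split; first exact: mu_geM.
  have nlt : (n < (n + n').+1)%N by rewrite ltnS leq_addr.
  rewrite /mu_term nderivnM (bigD1 (Ordinal nlt)) //= addKn; set S := \sum_(i < _ | _) _.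
  have := mu_termM eps f g (leq_addr n' n); rewrite addKn fn gn /=.
  case e: (nu (_ * _)) => [x|] //= [ex].
  rewrite (nuD_eq e) /= ?ex //.
  apply: gto_nu_sum => i ni.
  rewrite -[x](addrK (eps *+ (n + n'))) ex -(gto_shift _ (eps *+ (n + n'))).
  rewrite mu_termM -1?ltnS //.
  have : (i < n)%N || (n < i)%N by rewrite -neq_ltn; move: ni; rewrite -val_eqE.
  case/orP => hi; last exact: (gto_addo Hle (fgt _ hi) (gw _)).
  by apply: geo_gto_addo => //; apply: ggt; rewrite ltn_subRL ltn_add2r.
move=> s ns; rewrite /mu_term gto_shift nderivnM; apply: gto_nu_sum => i _.
rewrite -(gto_shift _ (eps *+ s)) mu_termM -1?ltnS //.
have [hi|hi] := ltnP n i; first exact: (gto_addo Hle (fgt _ hi) (gw _)).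
apply: geo_gto_addo => //; apply: ggt; rewrite ltn_subRL.
by apply: leq_ltn_trans ns; rewrite leq_add2r.
Qed.

Lemma mu_leadD eps f g w n : mu_lead eps f w n -> mu_ge eps g w ->
  (forall s, (n <= s)%N -> gto w (mu_term eps g s)) -> mu_lead eps (f + g) w n.
Proof.
case=> fw fn fgt gw ggt; split; first exact: mu_geD.
  move: fn (ggt _ (leqnn n)); rewrite /mu_term nderivnD gto_shift.
  case e: (nu _) => [x|] //= [ex]; rewrite -ex addrK => h.
  by rewrite (nuD_eq e h).
move=> s ns; move: (fgt _ ns) (ggt _ (ltnW ns)).
by rewrite /mu_term !gto_shift nderivnD; apply: gto_nuD.
Qed.

(** The derivative of order [deg f] is the leading coefficient, a nonzero constant, so the minimum
    is finite even if [nu] has nonzero support. Higher derivatives vanish, which leaves finitely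
    many indices. *)
Lemma mu_lead_exists eps f : f != 0 -> exists w n, mu_lead eps f w n.
Proof.
move=> f0; have sf : (size f).-1.+1 = size f by rewrite prednK // lt0n size_poly_eq0.
have [|n [w [nN hn ge gt]]] := @last_argmin _ _ Hle (mu_term eps f) (size f).-1.
  exists (size f).-1 => //; rewrite /mu_term.
  have -> : f^`N((size f).-1) = (lead_coef f)%:P.
    apply/polyP => i; rewrite coef_nderivn coefC; case: i => [|i] /=.
      by rewrite addn0 binn.
    by rewrite nth_default ?mul0rn // addnS -addSn sf leq_addr.
  by have [|x ->] := @nuC_finite (lead_coef f); rewrite ?lead_coef_eq0.
have big s : ((size f).-1 < s)%N -> mu_term eps f s = None.
  by rewrite sf => h; rewrite /mu_term nderivn_poly0 // nu0.
exists w, n; split=> // s.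
  by have [/ge//|/big->] := leqP s (size f).-1.
by move=> ns; have [h|/big->//] := leqP s (size f).-1; apply: gt; rewrite ns.
Qed.

(* The last minimal index of [Q * g] is positive while that of [c] is 0, so the two initial forms
   cannot cancel. *)
Lemma mu_ge_split eps Q c g q n w :
  mu_lead eps Q q n -> (0 < n)%N ->
  (forall x, nu c = Some x -> mu_lead eps c x 0) -> (nu c = None -> c = 0) ->
  mu_ge eps (g * Q + c) w -> geo w (nu c) /\ mu_ge eps g (w - q).
Proof.
move=> lQ n0 lc c0; have [->|gn0] := eqVneq g 0.
  rewrite mul0r add0r => h; split; [apply: mu_ge_nu h | apply: mu_ge0].
move=> h; have [w' [n' lg]] := mu_lead_exists eps gn0.
have [gQ gQn _] := mu_leadM lg lQ.
suff ww : le w (w' + q).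
  split; last by case: lg => + _ _; apply: mu_ge_le; rewrite -(le_D2r Hle q) subrK.
  have -> : c = (g * Q + c) - g * Q by rewrite addrC addKr.
  by apply: (@mu_ge_nu eps); apply: mu_geB => //; apply: mu_ge_le gQ.
rewrite (leLNgt Hle); apply/negP => lt.
case ec: (nu c) => [x|]; last first.
  by have := h (n' + n)%N; rewrite (c0 ec) addr0 gQn geoE (leLNgt Hle) lt.
have [cx cx0 cgt] := lc _ ec.
(* At index [n' + n > 0] the term of [c] lies strictly above [x]. If [x >= w' + q], the product
   would survive there with value [w' + q < w]. So [x < w' + q], and now [c] survives at index 0
   with value [x < w]. *)
have xw : ltL le x (w' + q).
  have := cgt (n' + n)%N; rewrite addn_gt0 n0 orbT => /(_ isT) h1.
  rewrite (ltLNge Hle); apply/negP => h2; have := h (n' + n)%N.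
  move: h1 => /(gto_le Hle h2) h1; move: gQn h1.
  rewrite /mu_term gto_shift nderivnD.
  case e: (nu _) => [y|] //= [ey]; rewrite -ey addrK => h1.
  by rewrite (nuD_eq e h1) /= ey geoE (leLNgt Hle) lt.
have gtx : gto x (nu (g * Q)) by apply: gto_lt (mu_ge_nu gQ).
have := mu_ge_nu h; rewrite addrC (nuD_eq ec gtx) geoE.
by rewrite (leLNgt Hle) (lt_tr Hle xw lt).
Qed.

End Valuation.

(** * Formal properties of [Q]-expansions *)

Section QExpansion.
Variable K : fieldType.
Implicit Types Q f g : {poly K}.

Lemma qcoef0 Q f : qcoef Q f 0 = f %% Q.
Proof. by rewrite /qcoef expr0 divp1. Qed.

Lemma qcoefS Q f i : qcoef Q f i.+1 = qcoef Q (f %/ Q) i.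
Proof. by rewrite /qcoef divp_divl exprS. Qed.

Lemma qcoefD Q f g i : qcoef Q (f + g) i = qcoef Q f i + qcoef Q g i.
Proof. by rewrite /qcoef divpD modpD. Qed.

Lemma qcoef_0 Q i : qcoef Q 0 i = 0.
Proof. by rewrite /qcoef div0p mod0p. Qed.

Lemma qcoef_sum Q I (r : seq I) (E : I -> {poly K}) i :
  qcoef Q (\sum_(j <- r) E j) i = \sum_(j <- r) qcoef Q (E j) i.
Proof.
exact: (big_morph (fun f => qcoef Q f i) (fun f g => qcoefD Q f g i)
  (qcoef_0 Q i)).
Qed.

Lemma qcoefMn Q f n i : qcoef Q (f *+ n) i = qcoef Q f i *+ n.
Proof. by elim: n => [|n IHn]; rewrite ?qcoef_0 // !mulrS qcoefD IHn. Qed.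

Lemma size_qcoef Q f i : Q != 0 -> (size (qcoef Q f i) < size Q)%N.
Proof. exact: ltn_modpN0. Qed.

Lemma qcoef_mulX Q f i j : Q != 0 -> (j <= i)%N ->
  qcoef Q (f * Q ^+ j) i = qcoef Q f (i - j).
Proof.
move=> Q0; elim: j i => [|j IHj] i; first by rewrite expr0 mulr1 subn0.
by case: i => // i ji; rewrite qcoefS exprSr mulrA mulpK // IHj.
Qed.

Lemma qcoef_mulX_lt Q f i j : Q != 0 -> (i < j)%N -> qcoef Q (f * Q ^+ j) i = 0.
Proof.
move=> Q0; elim: i j => [|i IHi] [|j] // ij.
  by rewrite qcoef0 exprSr mulrA modp_mull.
by rewrite qcoefS exprSr mulrA mulpK // IHi.
Qed.

Lemma size_divp_lt Q f : (1 < size Q)%N -> f != 0 -> (size (f %/ Q)%R < size f)%N.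
Proof.
move=> Q1 f0; have Q0 : Q != 0 by apply: contraTN Q1 => /eqP->; rewrite size_poly0.
rewrite size_divp // ltn_subrL [X in _ && X]lt0n size_poly_eq0 f0 andbT.
by case: (size Q) Q1 => [|[]].
Qed.

Lemma qexpansion Q f N : (1 < size Q)%N -> (size f <= N)%N ->
  f = \sum_(i < N) qcoef Q f i * Q ^+ i.
Proof.
move=> Q1; elim: N f => [|N IHN] f; first by rewrite leqn0 size_poly_eq0 big_ord0 => /eqP.
move=> fN; rewrite big_ord_recl /= expr0 mulr1 qcoef0 {1}(divp_eq f Q) addrC; congr (_ + _).
have [->|f0] := eqVneq f 0.
  by rewrite div0p mul0r big1 // => i _; rewrite qcoef_0 mul0r.
rewrite {1}[f %/ Q]IHN ?mulr_suml; last by rewrite -ltnS (leq_trans (size_divp_lt Q1 f0)).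
by apply: eq_bigr => i _; rewrite /bump leq0n add1n qcoefS exprSr mulrA.
Qed.

Lemma qcoef_default Q f i : (1 < size Q)%N -> (size f <= i)%N -> qcoef Q f i = 0.
Proof.
move=> Q1; elim: i f => [|i IHi] f.
  by rewrite leqn0 size_poly_eq0 => /eqP->; rewrite qcoef_0.
have [->|f0] := eqVneq f 0; first by rewrite qcoef_0.
by move=> fi; rewrite qcoefS IHi // -ltnS (leq_trans (size_divp_lt Q1 f0)).
Qed.

Lemma size_qcoef_add Q f i : (1 < size Q)%N -> qcoef Q f i != 0 ->
  (size (qcoef Q f i) + i * (size Q).-1 <= size f)%N.
Proof.
move=> Q1 ci; have Q0 : Q != 0 by apply: contraTN Q1 => /eqP->; rewrite size_poly0.
have d0 : f %/ Q ^+ i != 0 by apply: contraNN ci => /eqP; rewrite /qcoef => ->; rewrite mod0p.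
have sd : size (f %/ Q ^+ i) = (size f - i * (size Q).-1)%N.
  by rewrite size_divp ?expf_neq0 // size_exp /= mulnC.
have le1 : (size (qcoef Q f i) <= size f - i * (size Q).-1)%N by rewrite -sd leq_modp.
have gt0 : (0 < size f - i * (size Q).-1)%N by rewrite -sd lt0n size_poly_eq0.
by move: le1; rewrite -(leq_add2r (i * (size Q).-1)) subnK // ltnW // -subn_gt0.
Qed.

End QExpansion.

(** * Key polynomials and the identification of [nu_Q] with [mu_eps] *)

Section KeyPolynomials.
Variables (K : fieldType) (L : lmodType rat) (le : rel L).
Hypothesis Hle : ordered_qspace le.
Variable nu : {poly K} -> option L.
Hypothesis Hnu : is_poly_valuation le nu.

Local Notation geo := (geo le).
Local Notation gto := (gto le).
Local Notation lt := (ltL le).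
Local Notation mu_ge := (mu_ge le nu).
Local Notation mu_lead := (mu_lead le nu).
Local Notation mu_term := (mu_term nu).

Lemma ltX_max x y z : ltX le (maxX le x y) z = ltX le x z && ltX le y z.
Proof.
rewrite /maxX; case: ifP => h.
  case yz: (ltX le y z); rewrite ?andbF // andbT; apply/esym.
  by case: x y z h yz => [|x|] [|y|] [|z|] //=; exact: (lt_tr Hle).
case xz: (ltX le x z) => //=; apply/esym.
case: x y z h xz => [|x|] [|y|] [|z|] //=.
by move/negbT; rewrite -(leLNgt Hle) => h; apply: (le_lt_tr Hle).
Qed.

Lemma ltX_foldr (h : nat -> xlevel L) r z s :
  ltX le (foldr (maxX le) (LNeg L) (map h r)) z -> s \in r -> ltX le (h s) z.
Proof.
elim: r => //= x r IHr; rewrite ltX_max => /andP[hx /IHr hr].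
by rewrite in_cons => /orP[/eqP->|/hr].
Qed.

Lemma foldr_maxX (h : nat -> xlevel L) r :
  let v := foldr (maxX le) (LNeg L) (map h r) in
  v = LNeg L \/ exists2 s, s \in r & v = h s.
Proof.
elim: r => [|x r IHr] /=; first by left.
rewrite {1 3}/maxX; case: ifP => _; last by right; exists x; rewrite ?mem_head.
by case: IHr => [->|[s sr ->]]; [left | right; exists s => //; rewrite in_cons sr orbT].
Qed.

Variable m : nat.
Hypothesis Hm : (0 < m)%N.

(* [eps] is the level of [Q], and every polynomial of smaller degree has
   level [< eps]. *)
Definition key_data (Q : {poly K}) (c eps : L) (n : nat) : Prop :=
  [/\ nu Q = Some c, mu_lead eps Q c n, (0 < n)%N &
      forall a : {poly K}, (size a <= m)%N ->
        (nu a = None -> a = 0) /\ (forall x, nu a = Some x -> mu_lead eps a x 0)].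

Lemma scale_invn (x : L) s : (0 < s)%N -> ((s%:R : rat)^-1 *: x) *+ s = x.
Proof.
move=> s0; rewrite -scaler_nat scalerA mulfV ?scale1r //.
by rewrite Num.Theory.pnatr_eq0 -lt0n.
Qed.

(** That [eps] is the maximal slope says exactly that all terms of [Q] are at least [c], with
    equality at some [s0 > 0]; the last minimal index is therefore positive. A level below [eps]
    means that all terms of positive index exceed the one at 0. *)
Lemma key_poly_data Q c : Psi le nu m Q -> nu Q = Some c ->
  exists eps n, key_data Q c eps n.
Proof.
move=> [[Qm Qkey] sQ] Qc; move: Qkey; rewrite sQ.
rewrite [level le nu Q]/level sQ ltnS leqNgt Hm /= Qc.
set h := fun s => _; set v := foldr _ _ _ => Qkey.
have hs s : h s = match nu Q^`N(s) with
  None => LNeg L | Some d => LFin ((s%:R : rat)^-1 *: (c - d)) end by [].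
have hv s : s \in iota 1 m -> ltX le v (h s) = false.
  move=> sm; apply/negP => /ltX_foldr/(_ sm).
  by case: (h s) => //= a; rewrite (ltLxx Hle).
have mm : m \in iota 1 m by rewrite mem_iota Hm add1n ltnSn.
(* This finite value keeps the maximum defining the level from being the default [LNeg]. *)
have Dm : nu Q^`N(m) = Some 0.
  suff -> : Q^`N(m) = 1 by rewrite (nu1 Hnu).
  apply/polyP => i; rewrite coef_nderivn coefC; case: i => [|i] /=.
    by rewrite addn0 binn; move/monicP: Qm; rewrite /lead_coef sQ.
  by rewrite nth_default ?mul0rn // sQ addnS ltnS leq_addr.
have [vN|[s0]] := foldr_maxX h (iota 1 m).
  by have := hv _ mm; rewrite /v vN hs Dm.
rewrite -/v => s0m vs0.
have : v = h s0 by [].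
rewrite hs; case Ds0: (nu Q^`N(s0)) => [d|] veps; last first.
  by have := hv _ mm; rewrite veps hs Dm.
set eps := _ *: _ in veps.
have s00 : (0 < s0)%N by move: s0m; rewrite mem_iota => /andP[].
have eqs0 : mu_term eps Q s0 = Some c.
  by rewrite /mu_term Ds0 /= scale_invn // addrC subrK.
have geQ : mu_ge eps Q c.
  move=> [|s]; first by rewrite mu_term0 Qc geoE (leLxx Hle).
  rewrite /mu_term; have [sm|sm] := ltnP s m; last first.
    by rewrite nderivn_poly0 ?sQ // (nu0 Hnu).
  have : s.+1 \in iota 1 m by rewrite mem_iota.
  move=> /hv; rewrite veps hs; case: (nu _) => [d'|] //= /negbT.
  rewrite -(leLNgt Hle) => /(leMn Hle s.+1); rewrite scale_invn // geoE => e.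
  by apply: le_transfer e _ => //; rewrite opprB [RHS]addrA [d' + _]addrC.
have [w [n lQ]] : exists w n, mu_lead eps Q w n.
  by apply: mu_lead_exists => //; rewrite monic_neq0.
have [gw ew gtw] := lQ.
have cw : w = c.
  by apply: (leL_anti Hle); [have := gw s0; rewrite eqs0 | have := geQ n; rewrite ew].
rewrite cw in lQ gtw ew.
exists eps, n; split=> //.
  rewrite (leq_trans s00) // leqNgt; apply/negP => /gtw.
  by rewrite eqs0 gtoE (ltLxx Hle).
move=> a am; have /Qkey : (size a < m.+1)%N by [].
rewrite veps /level; case: leqP => [a1 _|a1].
  have [b ->] : exists b, a = b%:P by exists a`_0; apply: size1_polyC.
  split=> [nb|x bx].
    by have [->|/(nuC_finite Hnu)[x]] := eqVneq b 0; rewrite ?polyC0 // nb.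
  have gt s : (0 < s)%N -> mu_term eps b%:P s = None.
    by case: s => // s _; rewrite /mu_term nderivnC (nu0 Hnu).
  split=> [[|s]||s /gt->//]; rewrite ?mu_term0 ?gt // bx //.
  by rewrite geoE (leLxx Hle).
(* A nonconstant [a] of infinite value would have level [LPos], which is below nothing. *)
case ea: (nu a) => [x|] // lta; split=> // x' [<-].
have gt s : (0 < s)%N -> gto x (mu_term eps a s).
  move=> s0'; have [sa|sa] := ltnP s (size a); last first.
    by rewrite /mu_term nderivn_poly0 ?(nu0 Hnu).
  have := ltX_foldr lta (s := s); rewrite mem_iota s0' add1n.
  rewrite prednK ?sa; last exact: ltn_trans a1.
  move=> /(_ isT); rewrite /mu_term; case: (nu _) => [d'|] //= h1.
  rewrite gtoE (ltLNge Hle); apply: contraTN h1 => h1.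
  rewrite -(leLNgt Hle); apply: (leMn_inv Hle s0'); rewrite scale_invn //.
  by apply: le_transfer h1 _ => //; rewrite opprD addrA.
split=> // [[|s]|]; rewrite ?mu_term0 ?ea ?geoE ?(leLxx Hle) //.
by apply: gto_geo; apply: gt.
Qed.

Section OneKey.
Variables (Q0 : {poly K}) (c0 eps : L) (n : nat).
Hypothesis kQ0 : key_data Q0 c0 eps n.
Hypotheses (mQ0 : Q0 \is monic) (sQ0 : size Q0 = m.+1).

(** In degree below [m] the minimum defining [mu_eps] sits at index 0, so [mu_eps] coincides with
    [nu] there. *)
Lemma small_mu_ge (a : {poly K}) w : (size a <= m)%N -> geo w (nu a) -> mu_ge eps a w.
Proof.
case: kQ0 => _ _ _ sm /sm[a0]; case: (nu a) a0 => [x|] a0 h wx.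
  by have [ge _ _] := h _ erefl; apply: mu_ge_le ge.
by rewrite a0 //; apply: mu_ge0.
Qed.

Variable Q : {poly K}.
Hypotheses (mQ : Q \is monic) (sQ : size Q = m.+1) (geQ : geo c0 (nu Q)).

Lemma size_monic_sub : (size (Q - Q0)%R <= m)%N.
Proof.
apply/leq_sizeP => j; rewrite leq_eqVlt coefB => /orP[/eqP<-|mj].
  have /monicP := mQ; have /monicP := mQ0.
  by rewrite /lead_coef sQ sQ0 /= => -> ->; rewrite subrr.
by rewrite !nth_default ?subrr ?sQ ?sQ0.
Qed.

(** The difference [Q - Q0] has degree below [m] and value at least [c0], so its terms of positive
    index exceed [c0]. Adding it to [Q0] leaves the initial form at [n > 0] in place. *)
Lemma key_lead : mu_lead eps Q c0 n.
Proof.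
have [Q0c lQ0 n0 sm] := kQ0.
have sz := size_monic_sub.
have ge : geo c0 (nu (Q - Q0)).
  by apply: (geo_nuB Hle Hnu) => //; rewrite Q0c geoE (leLxx Hle).
rewrite -[Q](subrK Q0) addrC; apply: (mu_leadD Hle Hnu) => //.
  exact: small_mu_ge.
move=> s ns; have [a0 lea] := sm _ sz.
case e: (nu (Q - Q0)) ge => [x|] ge; last first.
  by rewrite (a0 e) /mu_term raddf0 (nu0 Hnu).
by have [_ _ gt] := lea _ e; apply: (gto_le Hle ge); apply: gt; apply: leq_trans ns.
Qed.

(** Forward, [mu_ge_split] peels off one remainder after another, each division by [Q] lowering the
    bound by [c0]. Backward, every term of the expansion obeys the bound. As [Q] may differ from
    [Q0], valuations of different levels can be read off one common expansion. *)
Lemma mu_ge_qcoef f w :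
  mu_ge eps f w <-> forall k, geo w (addo (nu (qcoef Q f k)) (Some (c0 *+ k))).
Proof.
have Q1 : (1 < size Q)%N by rewrite sQ ltnS.
have Qn0 : Q != 0 by rewrite monic_neq0.
have lQ := key_lead; have [_ _ n0 sm] := kQ0.
have smod g : (size (g %% Q)%R <= m)%N by rewrite -ltnS -sQ ltn_modp.
split=> [h k|].
  elim: k f w h => [|k IHk] f w.
    rewrite {1}(divp_eq f Q) qcoef0 => h.
    have [a0 lea] := sm _ (smod f).
    have [] := mu_ge_split Hle Hnu lQ n0 lea a0 h.
    by case: (nu _) => //= x; rewrite !geoE mulr0n addr0.
  rewrite {1}(divp_eq f Q) qcoefS => h.
  have [a0 lea] := sm _ (smod f).
  have [_ /IHk] := mu_ge_split Hle Hnu lQ n0 lea a0 h.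
  by rewrite !(geo_shift Hle) mulrS opprD addrA.
have [N] := ubnP (size f); elim: N f w => // N IHN f w fN h.
have [->|f0] := eqVneq f 0; first exact: mu_ge0.
rewrite (divp_eq f Q); apply: (mu_geD Hle Hnu).
  have [ge _ _] := lQ; rewrite -[w](subrK c0); apply: (mu_geM Hle Hnu) ge.
  apply: IHN => [|k]; first by apply: leq_trans (size_divp_lt Q1 f0) _; rewrite -ltnS.
  by have := h k.+1; rewrite qcoefS !(geo_shift Hle) mulrS opprD addrA.
apply: small_mu_ge => //; have := h 0%N.
by rewrite qcoef0; case: (nu _) => //= x; rewrite !geoE mulr0n addr0.
Qed.

End OneKey.

Lemma nuQ_geoP Q c eps n f w : key_data Q c eps n -> Q \is monic -> size Q = m.+1 ->
  geo w (nuQ le nu Q f) <-> mu_ge eps f w.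
Proof.
move=> kQ mQ sQ; have [Qc _ _ _] := kQ.
have geQ : geo c (nu Q) by rewrite Qc geoE (leLxx Hle).
have Q1 : (1 < size Q)%N by rewrite sQ ltnS.
have mug := mu_ge_qcoef kQ mQ sQ mQ sQ geQ f w.
have e k : nu (qcoef Q f k * Q ^+ k) = addo (nu (qcoef Q f k)) (Some (c *+ k)).
  by rewrite (nuM Hnu) (nuX Hnu k Qc).
rewrite /nuQ (geo_foldr_mino Hle) all_map; split=> [/allP h|/mug h].
  apply/mug => k; rewrite -e.
  have [kf|kf] := ltnP k (size f); last by rewrite qcoef_default // mul0r (nu0 Hnu).
  by apply: h; rewrite mem_iota /= add0n ltnW.
by apply/allP => k _ /=; rewrite e.
Qed.

(** If all terms had infinite value, so would all coefficients, because [nu Q] is finite; having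
    degree below [m], they would be zero. *)
Lemma nuQ_finite Q c eps n f : key_data Q c eps n -> Q \is monic -> size Q = m.+1 ->
  f != 0 -> exists w, nuQ le nu Q f = Some w.
Proof.
move=> kQ mQ sQ; have [Qc _ _ sm] := kQ.
have Q1 : (1 < size Q)%N by rewrite sQ ltnS.
case e: (nuQ le nu Q f) => [w|]; first by exists w.
case/eqP; rewrite (qexpansion Q1 (leqnn (size f))) big1 // => i _.
suff -> : qcoef Q f i = 0 by rewrite mul0r.
have [] := sm (qcoef Q f i); first by rewrite -ltnS -sQ size_qcoef // monic_neq0.
move=> + _; apply.
have minN x y : mino le x y = None -> x = None /\ y = None.
  by rewrite /mino; case: x y => [x|] [y|] //=; case: ifP.
have : nu (qcoef Q f i * Q ^+ i) = None.
  have : val i \in iota 0 (size f).+1 by rewrite mem_iota /= add0n ltnW // ltnS.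
  move: e; rewrite /nuQ; elim: (iota _ _) => //= k r IHr /minN[ek er].
  by rewrite in_cons => /orP[/eqP->//|]; apply: IHr.
by rewrite (nuM Hnu) (nuX Hnu i Qc); case: (nu _).
Qed.

Lemma nuQ_le_nu Q c eps n f w : key_data Q c eps n -> Q \is monic -> size Q = m.+1 ->
  geo w (nuQ le nu Q f) -> geo w (nu f).
Proof. by move=> kQ mQ sQ /(nuQ_geoP _ _ kQ mQ sQ) /mu_ge_nu. Qed.

End KeyPolynomials.

(** * Values of polynomials of degree below [m] lie in [Gamma] *)

Section ValueGroup.
Variables (K : fieldType) (L : lmodType rat) (le : rel L).
Hypothesis Hle : ordered_qspace le.
Variable nu : {poly K} -> option L.
Hypothesis Hnu : is_poly_valuation le nu.

Local Notation mu_lead := (mu_lead le nu).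
Local Notation mu_ge := (mu_ge le nu).
Local Notation Gamma := (in_Gamma nu).

Lemma in_vKMn x n : in_vK nu x -> in_vK nu (x *+ n).
Proof.
case=> a [a0 ax]; exists (a ^+ n); split; first by rewrite expf_neq0.
by rewrite rmorphXn /= (nuX Hnu n ax).
Qed.

Lemma in_vK_Gamma x : in_vK nu x -> Gamma x.
Proof. by move=> h; exists 1%N; rewrite ?mulr1n. Qed.

Lemma Gamma_add x y : Gamma x -> Gamma y -> Gamma (x + y).
Proof.
case=> n n0 hx [k k0 hy]; exists (n * k)%N; first by rewrite muln_gt0 n0.
rewrite mulrnDl {2}mulnC !mulrnA.
have [a [a0 ax]] := in_vKMn k hx; have [b [b0 yb]] := in_vKMn n hy.
exists (a * b); rewrite mulf_neq0 //; split=> //.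
by rewrite rmorphM /= (nuM Hnu) ax yb.
Qed.

Lemma Gamma_opp x : Gamma x -> Gamma (- x).
Proof.
case=> n n0 [a [a0 ax]]; exists n => //; exists a^-1; rewrite invr_eq0; split=> //.
have := nuM Hnu a%:P a^-1%:P; rewrite -polyCM divff // (nu1 Hnu) ax.
case: (nu _) => [y|] //= [] /esym/eqP; rewrite addr_eq0 => /eqP h.
by rewrite mulNrn h opprK.
Qed.

Lemma Gamma_Mn x n : Gamma x -> Gamma (x *+ n).
Proof. by case=> k k0 h; exists k; rewrite // mulrnAC; apply: in_vKMn. Qed.

Lemma Gamma_div x n : (0 < n)%N -> Gamma (x *+ n) -> Gamma x.
Proof.
by move=> n0 [k k0 h]; exists (n * k)%N; rewrite ?muln_gt0 ?n0 // mulrnA.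
Qed.

Lemma mu_leadD_lt eps f g w w' n :
  mu_lead eps f w n -> mu_ge eps g w' -> ltL le w w' -> mu_lead eps (f + g) w n.
Proof.
move=> lf gg ww'; apply: (mu_leadD Hle Hnu) => //.
  by apply: mu_ge_le gg => //; apply: lt_le.
by move=> s _; apply: gto_lt (gg s).
Qed.

(* If [a] had value [x] outside [Gamma] and minimal degree, the terms of an
   [a]-expansion would have values in distinct classes modulo [Gamma], so every
   polynomial, in particular [Q] itself, would have level [< eps]. *)
Lemma nu_in_Gamma m Q c eps n (a : {poly K}) :
  key_data le nu m Q c eps n -> (size a <= m)%N -> a != 0 ->
  exists2 x, nu a = Some x & Gamma x.
Proof.
case=> Qc [Qge Qn _] n0 sm; have [N] := ubnP (size a); elim: N a => // N IHN a.
rewrite ltnS => aN am a0; have [afin alead] := sm _ am.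
case ax: (nu a) afin => [x|]; last by move=> /(_ erefl) e; rewrite e eqxx in a0.
move=> _; exists x => //; apply: NNPP => nx.
have a1 : (1 < size a)%N.
  rewrite ltnNge; apply/negP => /size1_polyC e; apply: nx; apply: in_vK_Gamma.
  by exists a`_0; rewrite -e ax -polyC_eq0 -e.
suff all f : f != 0 -> exists w k, mu_lead eps f w 0 /\ Gamma (w - x *+ k).
  have Q0 : Q != 0 by apply: contra_eqN Qc => /eqP->; rewrite (nu0 Hnu).
  have [w [_ [[_ w0 gt] _]]] := all _ Q0.
  have := gt _ n0; rewrite Qn gtoE (ltLNge Hle) => /negP; apply.
  by rewrite -geoE -w0.
have [M] := ubnP (size f); elim: M f => // M IHM f; rewrite ltnS => fM f0.
have smod : (size (f %% a)%R < size a)%N by rewrite ltn_modp.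
have Hr : f %% a = 0 \/ exists2 y, mu_lead eps (f %% a) y 0 & Gamma y.
  have [->|r0] := eqVneq (f %% a) 0; [by left | right].
  have [||//|y ry yG] := IHN (f %% a).
  - exact: leq_trans smod aN.
  - exact: ltnW (leq_trans smod am).
  exists y => //; have [_] := sm _ (ltnW (leq_trans smod am)); exact.
have Hg : f %/ a = 0 \/
    exists w k, mu_lead eps (f %/ a * a) w 0 /\ Gamma (w - x *+ k.+1).
  have [->|g0] := eqVneq (f %/ a) 0; [by left | right].
  have [|//|w [k [lw wG]]] := IHM (f %/ a).
    exact: leq_trans (size_divp_lt a1 f0) fM.
  exists (w + x), k; split; last by rewrite mulrS opprD addrA addrK.
  by rewrite -(addn0 0%N); apply: (mu_leadM Hle Hnu) => //; apply: alead.
have fE := divp_eq f a.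
case: Hr Hg => [r0|[y ly yG]] [g0|[w [k [lw wG]]]].
- by move: f0; rewrite fE r0 g0 mul0r addr0 eqxx.
- by exists w, k.+1; rewrite fE r0 addr0.
- by exists y, 0%N; rewrite fE g0 mul0r add0r mulr0n subr0.
have [yge _ _] := ly; have [wge _ _] := lw.
have [yw|yw] := boolP (ltL le y w).
  exists y, 0%N; rewrite fE addrC mulr0n subr0; split=> //.
  exact: mu_leadD_lt ly wge yw.
exists w, k.+1; rewrite fE; split=> //; apply: mu_leadD_lt lw yge _.
rewrite (ltLNge Hle); apply: contra yw => yw.
rewrite (ltLNge Hle); apply/negP => wy; apply: nx.
apply: (@Gamma_div _ k.+1) => //.
have -> : x *+ k.+1 = y - (w - x *+ k.+1).
  by rewrite (leL_anti Hle yw wy) opprB addrC subrK.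
by apply: Gamma_add => //; apply: Gamma_opp.
Qed.

End ValueGroup.

(** * Cofinal families of key polynomials, monotonicity and stability *)

Section LimitKeyPolynomial.
Variables (K : fieldType) (L : lmodType rat) (le : rel L).
Hypothesis Hle : ordered_qspace le.
Variable nu : {poly K} -> option L.
Hypothesis Hnu : is_poly_valuation le nu.
Variable m : nat.
Hypothesis Hm : (0 < m)%N.
Hypothesis HPsi_ne : exists Q, Psi le nu m Q.
Hypothesis HPsi_nomax : forall Q, Psi le nu m Q ->
  exists R, Psi le nu m R /\ lto le (nu Q) (nu R).
Variable QQ : {poly K} -> Prop.
Hypothesis HQQ : forall Q, QQ Q -> Psi le nu m Q.
Hypothesis HQQcof : cofinal_in_Psi le nu m QQ.

Local Notation geo := (geo le).
Local Notation gto := (gto le).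
Local Notation lt := (ltL le).
Local Notation mu_ge := (mu_ge le nu).
Local Notation mu_lead := (mu_lead le nu).
Local Notation Gamma := (in_Gamma nu).
Local Notation eventually := (eventually le nu QQ).
Local Notation nuQ := (nuQ le nu).
Local Notation qleq Q R := (leo le (nu Q) (nu R)).

Definition QQ_data (Q : {poly K}) (c eps : L) (n : nat) : Prop :=
  [/\ QQ Q, key_data le nu m Q c eps n, Q \is monic, size Q = m.+1 & Gamma c].

(** Since some [R] in [Psi] has larger value, [nu Q] is finite and equals [nu (Q - R)]. This
    difference has degree below [m], whence the value is in [Gamma]. *)
Lemma QQ_dataP Q : QQ Q -> exists c eps n, QQ_data Q c eps n.
Proof.
move=> QQQ; have PQ := HQQ QQQ; have [[mQ _] sQ] := PQ.
have [R [PR]] := HPsi_nomax PQ; case Qc: (nu Q) => [c|]; last by case: (nu R).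
move=> QR; have [eps [n kQ]] := key_poly_data Hle Hnu Hm PQ Qc.
exists c, eps, n; split=> //.
have [[mR _] sR] := PR.
have e : nu (Q - R) = Some c by apply: (nuD_eq Hle Hnu); rewrite ?(nuN Hnu).
have Q0 : Q - R != 0 by apply: contra_eqN e => /eqP->; rewrite (nu0 Hnu).
have [x] := nu_in_Gamma Hle Hnu kQ (size_monic_sub mR sR mQ sQ) Q0.
by rewrite e => -[->].
Qed.

Lemma QQ_nonempty : exists Q, QQ Q.
Proof. by case: HPsi_ne => P /HQQcof[Q [QQQ _]]; exists Q. Qed.

Lemma QQ_nomax Q : QQ Q -> exists2 R, QQ R & lto le (nu Q) (nu R).
Proof.
move=> /HQQ/HPsi_nomax[P [/HQQcof[R [QQR PR]]]] /andP[QP nPQ]; exists R => //.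
rewrite /lto (leo_tr Hle QP PR); apply: contra nPQ; exact: leo_tr.
Qed.

Lemma eventually_and P P' : eventually P -> eventually P' ->
  eventually (fun Q => P Q /\ P' Q).
Proof.
case=> [Q1 [QQ1 h1]] [Q2 [QQ2 h2]].
have [h|h] := orP (leo_total Hle (nu Q1) (nu Q2)).
  exists Q2; split=> // Q QQQ hQ; split; last exact: h2.
  by apply: h1 => //; apply: leo_tr h hQ.
exists Q1; split=> // Q QQQ hQ; split; first exact: h1.
by apply: h2 => //; apply: leo_tr h hQ.
Qed.

Lemma eventually_ge R : QQ R -> eventually (fun Q => QQ Q /\ qleq R Q).
Proof. by move=> QQR; exists R. Qed.

(** Both sides are computed on the [R]-expansion of [f], with [R] weighted by [nu Q] for [nu_Q] and
    by the larger [nu R] for [nu_R]. *)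
Lemma nuQ_mono Q R f w : QQ Q -> QQ R -> qleq Q R ->
  geo w (nuQ Q f) -> geo w (nuQ R f).
Proof.
move=> /QQ_dataP[c [e [n [_ kQ mQ sQ _]]]] /QQ_dataP[c' [e' [n' [_ kR mR sR _]]]] QR.
have [Qc _ _ _] := kQ; have [Rc _ _ _] := kR; rewrite Qc Rc /= in QR.
move=> /(nuQ_geoP Hle Hnu Hm f w kQ mQ sQ).
have geR : geo c (nu R) by rewrite Rc.
have geR' : geo c' (nu R) by rewrite Rc geoE (leLxx Hle).
move=> /(mu_ge_qcoef Hle Hnu Hm kQ mQ sQ mR sR geR) h.
apply/(nuQ_geoP Hle Hnu Hm f w kR mR sR).
apply/(mu_ge_qcoef Hle Hnu Hm kR mR sR mR sR geR') => k.
have := h k; case: (nu _) => [x|] //=; rewrite !geoE => /(le_tr Hle); apply.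
by apply: leD => //; [apply: leLxx | apply: leMn].
Qed.

(** Let [nu_Q1 f = nu f = w] and [c = nu Q1]. For [Q] of value above [c], the quotient of [f] by [Q]
    has value at least [w - c], so its product with [Q] lies strictly above [w] and the remainder
    carries the value of [f]. *)
Lemma stable_mod f : stable le nu QQ f ->
  eventually (fun Q => nu (f %% Q) = nu f).
Proof.
case=> Q1 [QQ1 h]; have [->|f0] := eqVneq f 0.
  by exists Q1; split=> // Q _ _; rewrite mod0p.
have [Q2 QQ2 Q12] := QQ_nomax QQ1.
have [c [e [n [_ kQ1 mQ1 sQ1 _]]]] := QQ_dataP QQ1.
have [w ew] := nuQ_finite Hnu Hm kQ1 mQ1 sQ1 f0.
have fw : nu f = Some w by rewrite -(h _ QQ1 (leo_refl Hle _)).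
exists Q2; split=> // Q QQQ Q2Q.
have [c' [e' [n' [_ kQ mQ sQ _]]]] := QQ_dataP QQQ.
have [Q1c _ n0 sm] := kQ1.
have gtQ : gto c (nu Q).
  move: Q12; rewrite Q1c => /andP[h1 h2]; rewrite gtoNle //.
  by apply: contra h2; apply: (leo_tr Hle).
have lQ := key_lead Hle Hnu kQ1 mQ1 sQ1 mQ sQ (gto_geo gtQ).
have := leLxx Hle w; rewrite -geoE -ew => /(nuQ_geoP Hle Hnu Hm f w kQ1 mQ1 sQ1).
rewrite {1}(divp_eq f Q) => hf.
have [|a0 lea] := sm (f %% Q); first by rewrite -ltnS -sQ ltn_modp monic_neq0.
have [_ /mu_ge_nu ge] := mu_ge_split Hle Hnu lQ n0 lea a0 hf.
have gtgQ : gto w (nu (f %/ Q * Q)).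
  by rewrite (nuM Hnu) -[w](subrK c); apply: geo_gto_addo.
have -> : f %% Q = f + - (f %/ Q * Q) by rewrite {2}(divp_eq f Q) [X in X - _]addrC addrK.
by rewrite fw; apply: (nuD_eq Hle Hnu) => //; rewrite (nuN Hnu).
Qed.

(** * The limit key polynomial, and the index 0 *)

Variable F : {poly K}.
Hypothesis HF : limit_key_poly le nu QQ F.

Lemma F_neq0 : F != 0. Proof. by case: HF => /monic_neq0. Qed.

Lemma stable_lt (f : {poly K}) : (size f < size F)%N -> stable le nu QQ f.
Proof.
move=> h; apply: NNPP => nf; case: HF => _ _ /(_ _ nf).
by rewrite leqNgt h.
Qed.

(** If 0 were in [J], some remainder [H] of [F] modulo [R] would lie above every [nu_Q F]. Write
    [F = G * R + H] with [G] stable. For large [Q], [nu F > nu_Q F] would make [nu (G * R)] exceed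
    [nu_Q F]; as [mu_e] of [G * R] is at least that value, [mu_e F], which is [nu_Q F], would exceed
    itself. Hence [F] would be stable. *)
Lemma inB0 : inB le nu m QQ F 0.
Proof.
split=> // -[_ [R [QQR HR]]].
have := HR _ QQR (leo_refl Hle _).
have [r [eR [nR [_ kR mR sR _]]]] := QQ_dataP QQR; have [Rr _ _ _] := kR.
have R1 : (1 < size R)%N by rewrite sR ltnS.
rewrite /beta qcoef0; set H := F %% R => above.
have sH : (size H <= m)%N by rewrite -ltnS -sR ltn_modp monic_neq0.
have Habove Q w : QQ Q -> nuQ Q F = Some w -> gto w (nu H).
  move=> QQQ eQ; case: above; first by case: (nu H) => //= x; rewrite Rr.
  case=> y [ey yG ny]; move: ey; rewrite Rr /=; case: (nu H) => // x [].
  rewrite mulr0n addr0 => ->; rewrite gtoE (ltLNge Hle); apply/negP => yw.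
  by apply: ny; split=> //; exists Q; split; rewrite // eQ.
case: HF => _ nstab _; apply: nstab.
have [Q1 [QQ1 h1]] := stable_lt (size_divp_lt R1 F_neq0).
have [Q2 [QQ2 h2]] : eventually (fun Q => nuQ Q (F %/ R) = nu (F %/ R) /\ QQ Q /\ qleq R Q).
  by apply: eventually_and (eventually_ge QQR); exists Q1.
exists Q2; split=> // Q QQQ /(h2 _ QQQ)[eG [_ RQ]].
have [c [e [n [_ kQ mQ sQ _]]]] := QQ_dataP QQQ; have [Qc Qlead _ _] := kQ.
have [w ew] := nuQ_finite Hnu Hm kQ mQ sQ F_neq0; rewrite ew.
have gtH := Habove _ _ QQQ ew.
have geF : geo w (nu F) by apply: (nuQ_le_nu Hle Hnu Hm kQ mQ sQ); rewrite ew geoE (leLxx Hle).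
apply/esym/(eq_geoP Hle); split=> //; apply/negP => gtF.
have FE := divp_eq F R; rewrite -/H in FE.
set G := F %/ R in FE eG.
have gtG : gto w (nu (G * R)).
  have -> : G * R = F - H by rewrite FE addrK.
  by apply: (gto_nuD Hle Hnu) => //; rewrite (nuN Hnu).
have muR : mu_ge e R r.
  rewrite -[R](subrK Q); apply: (mu_geD Hle Hnu).
    apply: (small_mu_ge Hle Hnu kQ); first exact: (size_monic_sub mQ sQ mR sR).
    apply: (geo_nuB Hle Hnu); first by rewrite Rr geoE (leLxx Hle).
    by rewrite Rr in RQ.
  by case: Qlead => Qge _ _; apply: mu_ge_le Qge => //; rewrite Rr Qc in RQ.
have [G0|Gn0] := eqVneq G 0.
  move: gtH; rewrite -(_ : F = H); last by rewrite FE G0 mul0r add0r.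
  have sF : (size F <= m)%N by rewrite FE G0 mul0r add0r.
  case eF: (nu F) => [x|]; last first.
    by have [_ _ _ /(_ _ sF)[/(_ eF) F0]] := kQ; have := F_neq0; rewrite F0 eqxx.
  have : mu_ge e F x by apply: (small_mu_ge Hle Hnu kQ); rewrite // eF geoE (leLxx Hle).
  move=> /(nuQ_geoP Hle Hnu Hm F x kQ mQ sQ); rewrite ew geoE gtoE (ltLNge Hle).
  by move=> ->.
have [g eg] := nuQ_finite Hnu Hm kQ mQ sQ Gn0.
have muG : mu_ge e G g.
  by apply/(nuQ_geoP Hle Hnu Hm G g kQ mQ sQ); rewrite eg geoE (leLxx Hle).
have muGR := mu_geM Hle Hnu muG muR.
have eGR : nu (G * R) = Some (g + r) by rewrite (nuM Hnu) -eG eg Rr.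
(* The witness is the minimum of [nu (G * R)] and [nu H], where [nu H] may be infinite. *)
have [w1 [ww1 w1G w1H]] : exists w1, [/\ lt w w1, le w1 (g + r) & geo w1 (nu H)].
  rewrite eGR gtoE in gtG.
  case: (nu H) gtH => [x|] gtH; last by exists (g + r); rewrite (leLxx Hle).
  have [h|h] := boolP (le x (g + r)); first by exists x; rewrite geoE (leLxx Hle).
  by exists (g + r); rewrite (leLxx Hle); split=> //; apply: lt_le; rewrite (ltLNge Hle).
have : mu_ge e F w1.
  rewrite FE; apply: (mu_geD Hle Hnu); first exact: mu_ge_le muGR.
  exact: (small_mu_ge Hle Hnu kQ).
move=> /(nuQ_geoP Hle Hnu Hm F w1 kQ mQ sQ); rewrite ew geoE.
by rewrite (leLNgt Hle) ww1.
Qed.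

(** * Comparison of [R]-expansions with [Q]-expansions *)

Lemma mod_exp_sub (R Q c : {poly K}) k :
  (c * (R - Q) ^+ k) %% Q = (c * R ^+ k) %% Q.
Proof.
elim: k c => [|k IHk] c; first by rewrite !expr0.
rewrite !exprS !mulrA IHk -mulrA [(R - Q) * _]mulrC mulrA -modp_mul.
by rewrite modpD modpN modpp oppr0 addr0 modp_mul mulrAC.
Qed.

Lemma leL_opp x y : le x y -> le (- y) (- x).
Proof. by move=> h; apply: le_transfer h _ => //; rewrite opprK addrC. Qed.

(* The [l]-th [Q]-coefficient of [c R^i] is, up to a controlled error, the
   remainder modulo [Q] of the [l]-th divided derivative of [c R^i] with respect
   to [R]. *)
Lemma qcoef_change Q0 g0 e0 n0 R r Q (c : {poly K}) v i l :
  QQ_data Q0 g0 e0 n0 -> nu R = Some r -> le g0 r -> R \is monic -> size R = m.+1 ->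
  Q \is monic -> size Q = m.+1 -> geo r (nu Q) ->
  (size c <= m)%N -> geo v (nu c) ->
  geo (v + r *+ i - r *+ l + (r - g0))
    (nu (qcoef Q (c * R ^+ i) l - (c * R ^+ (i - l) *+ 'C(i, l)) %% Q)).
Proof.
move=> [_ kQ0 mQ0 sQ0 _] Rr g0r mR sR mQ sQ rQ sc vc; set E := v + _ - _ + _.
have Qn0 : Q != 0 by rewrite monic_neq0.
have geQ : geo g0 (nu Q) by apply: geo_le rQ.
set a := R - Q; have sa : (size a <= m)%N by exact: (size_monic_sub mQ sQ mR sR).
have ra : geo r (nu a) by apply: (geo_nuB Hle Hnu) => //; rewrite Rr geoE (leLxx Hle).
have mua := small_mu_ge Hle Hnu kQ0 sa ra.
have muc := small_mu_ge Hle Hnu kQ0 sc vc.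
have -> : c * R ^+ i = \sum_(j < i.+1) (c * a ^+ (i - j) * Q ^+ j) *+ 'C(i, j).
  rewrite -{1}[R](subrK Q) exprDn mulr_sumr; apply: eq_bigr => j _.
  by rewrite mulrnAr mulrA.
rewrite qcoef_sum.
(* For [j < l], each of the [l - j] further divisions by [Q] costs only [g0] instead of [r], a total
   gain of [l - j] times [r - g0], hence at least [r - g0]. For [j > l] the coefficient is zero. *)
have small (j : 'I_i.+1) : (j != l :> nat) ->
    geo E (nu (qcoef Q (c * a ^+ (i - j) * Q ^+ j *+ 'C(i, j)) l)).
  move=> jl; rewrite qcoefMn; apply: (geo_nuMn Hle Hnu).
  have [lj|] := ltnP l j; first by rewrite qcoef_mulX_lt // (nu0 Hnu).
  rewrite leq_eqVlt (negPf jl) /= => jl'; rewrite qcoef_mulX //; last exact: ltnW.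
  have := mu_geM Hle Hnu muc (mu_ge_exp Hle Hnu (i - j) mua).
  move=> /(mu_ge_qcoef Hle Hnu Hm kQ0 mQ0 sQ0 mQ sQ geQ) /(_ (l - j)%N).
  rewrite (geo_shift Hle); apply: (geo_le Hle); rewrite /E.
  have ji : (j <= i)%N by rewrite -ltnS.
  rewrite -{1}(subnKC ji) -{1}(subnKC jl'); set p := (i - j)%N.
  have -> : (l - j = (l - j.+1).+1)%N by rewrite -subSn // subSS.
  set q := (l - j.+1)%N.
  rewrite addSnnS !mulrnDr !mulrS [r *+ j + r *+ p]addrC (addrA v) addrKA.
  rewrite !opprD !addrA (addrAC _ _ r) subrK (addrAC _ (- g0)).
  rewrite le_D2r //; apply: leD; rewrite ?leLxx //.
  by apply: leL_opp; apply: leMn.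
have [il|li] := ltnP i l.
  rewrite bin_small // mulr0n mod0p subr0.
  apply: (geo_nu_sum Hle Hnu) => j _; apply: small.
  by rewrite neq_ltn (leq_ltn_trans _ il) // -ltnS.
have li' : (l < i.+1)%N by [].
rewrite (bigD1 (Ordinal li')) //= qcoefMn qcoef_mulX // subnn -qcoef0 qcoefMn !qcoef0.
rewrite mod_exp_sub addrAC subrr add0r.
apply: (geo_nu_sum Hle Hnu) => j; rewrite -val_eqE /=; exact: small.
Qed.

(** This is the Hasse derivative of order [l] of the [R]-expansion of [F], with [R] treated as the
    variable and the coefficients as constants. *)
Definition Rderiv (R : {poly K}) (l : nat) : {poly K} :=
  \sum_(i < size F) qcoef R F i * R ^+ (i - l) *+ 'C(i, l).

Lemma size_Rderiv (R : {poly K}) l : size R = m.+1 -> (0 < l)%N ->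
  (size (Rderiv R l) < size F)%N.
Proof.
move=> sR l0; have R1 : (1 < size R)%N by rewrite sR ltnS.
have F0 : (0 < size F)%N by rewrite lt0n size_poly_eq0 F_neq0.
rewrite -(prednK F0) ltnS; apply: leq_trans (size_sum _ _ _) _.
apply/bigmax_leqP => i _; rewrite -scaler_nat.
have [c0|cn0] := eqVneq (qcoef R F i) 0.
  by rewrite c0 mul0r scaler0 size_poly0.
have [il|li] := ltnP i l; first by rewrite bin_small // mulr0n scale0r size_poly0.
have cF := size_qcoef_add R1 cn0; rewrite sR /= in cF.
apply: leq_trans (leq_trans (size_scale_leq _ _) (size_mul_leq _ _)) _.
rewrite -ltnS (prednK F0); apply: leq_trans cF.
have := size_poly_exp_leq R (i - l); rewrite sR /= mulnC => sX.
have c1 : (0 < size (qcoef R F i))%N by rewrite lt0n size_poly_eq0.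
rewrite (@leq_ltn_trans (size (qcoef R F i) + (i - l) * m)) //.
  by rewrite -ltnS prednK ?addn_gt0 ?c1 // -addnS leq_add2l.
by rewrite ltn_add2l ltn_mul2r Hm ltn_subrL l0 (leq_trans l0 li).
Qed.

(** The bound of [qcoef_change] is summed over the [R]-expansion with [v = wR - r *+ i], so that the
    dependence on [i] cancels. *)
Lemma qcoef_Rderiv Q0 g0 e0 n0 R r eR nR wR Q l :
  QQ_data Q0 g0 e0 n0 -> QQ_data R r eR nR -> le g0 r -> nuQ R F = Some wR ->
  QQ Q -> qleq R Q ->
  geo (wR - r *+ l + (r - g0)) (nu (qcoef Q F l - Rderiv R l %% Q)).
Proof.
move=> d0 [_ kR mR sR _] g0r ewR QQQ RQ; have [Rr _ _ _] := kR.
have [c [e [n [_ kQ mQ sQ _]]]] := QQ_dataP QQQ.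
have R1 : (1 < size R)%N by rewrite sR ltnS.
have -> : qcoef Q F l - Rderiv R l %% Q = \sum_(i < size F)
   (qcoef Q (qcoef R F i * R ^+ i) l - (qcoef R F i * R ^+ (i - l) *+ 'C(i, l)) %% Q).
  rewrite {1}(qexpansion R1 (leqnn (size F))) qcoef_sum -qcoef0 qcoef_sum -sumrB.
  by under [RHS]eq_bigr => i _ do rewrite -qcoef0.
apply: (geo_nu_sum Hle Hnu) => i _.
have geR : geo r (nu R) by rewrite Rr geoE (leLxx Hle).
have ci : geo (wR - r *+ i) (nu (qcoef R F i)).
  have /(mu_ge_qcoef Hle Hnu Hm kR mR sR mR sR geR) h : mu_ge eR F wR.
    by apply/(nuQ_geoP Hle Hnu Hm F wR kR mR sR); rewrite ewR geoE (leLxx Hle).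
  by rewrite -(geo_shift Hle); apply: h.
have sc : (size (qcoef R F i) <= m)%N by rewrite -ltnS -sR size_qcoef // monic_neq0.
have := qcoef_change i l d0 Rr g0r mR sR mQ sQ _ sc ci.
by rewrite subrK; apply; rewrite Rr in RQ.
Qed.

(** On the [Q]-expansion of [F], lowering the weight of [Q] from [q] to [r] turns [nu_Q] into [nu_R]
    and costs at most [(q - r) *+ k] at index [k], and nonzero coefficients have [k < size F]. *)
Lemma nuQ_slope R r eR nR wR Q q eQ nQ wQ :
  QQ_data R r eR nR -> QQ_data Q q eQ nQ -> le r q ->
  nuQ R F = Some wR -> nuQ Q F = Some wQ ->
  le wQ (wR + (q - r) *+ size F).
Proof.
move=> [_ kR mR sR _] [_ kQ mQ sQ _] rq ewR ewQ.
have [Rr _ _ _] := kR; have [Qq _ _ _] := kQ.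
have geQ : geo q (nu Q) by rewrite Qq geoE (leLxx Hle).
have geQ' : geo r (nu Q) by rewrite Qq.
have Q1 : (1 < size Q)%N by rewrite sQ ltnS.
have := leLxx Hle wQ; rewrite -geoE -ewQ => /(nuQ_geoP Hle Hnu Hm F wQ kQ mQ sQ).
move=> /(mu_ge_qcoef Hle Hnu Hm kQ mQ sQ mQ sQ geQ) h.
rewrite -(le_D2r Hle (- ((q - r) *+ size F))) addrK -geoE -ewR.
apply/(nuQ_geoP Hle Hnu Hm F _ kR mR sR).
apply/(mu_ge_qcoef Hle Hnu Hm kR mR sR mQ sQ geQ') => k.
have [kF|kF] := leqP (size F) k; first by rewrite qcoef_default // (nu0 Hnu).
have := h k; rewrite !(geo_shift Hle); apply: (geo_le Hle).
have rq0 : le 0 (q - r) by rewrite -le_subr.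
have -> : wQ - q *+ k = wQ - (q - r) *+ k - r *+ k.
  by rewrite mulrnBl opprB addrA (addrAC _ (- (q *+ k))) addrK.
rewrite le_D2r //; apply: leD; rewrite ?leLxx //.
by apply: leL_opp; apply: le0M => //; apply: ltnW.
Qed.

Lemma inB_frequently l P : inB le nu m QQ F l -> eventually P ->
  exists Q c b, [/\ QQ Q, P Q, nu Q = Some c, nu (qcoef Q F l) = Some b &
    exists2 Q', QQ Q' & geo (b + c *+ l) (nuQ Q' F)].
Proof.
case=> lD nJ [Q0 [QQ0 hP]]; apply: NNPP => nex; apply: nJ; split=> //.
exists Q0; split=> // Q QQQ Q0Q.
have [c [e [n [_ kQ mQ sQ cG]]]] := QQ_dataP QQQ; have [Qc _ _ _] := kQ.
rewrite /above_delta /beta Qc /=; case eb: (nu _) => [b|]; last by left.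
(* Being above the cut includes membership in [Gamma], which [nu_in_Gamma] provides for [b]. *)
right; exists (b + c *+ l); split=> //.
  apply: (Gamma_add Hnu); last exact: (Gamma_Mn Hnu).
  have [||x] := nu_in_Gamma Hle Hnu kQ (a := qcoef Q F l).
  - by rewrite -ltnS -sQ size_qcoef // monic_neq0.
  - by apply: contra_eqN eb => /eqP->; rewrite (nu0 Hnu).
  by rewrite eb => -[->].
case=> _ [Q' [QQ' h]]; apply: nex; exists Q, c, b; split=> //; first exact: hP.
by exists Q'.
Qed.

(** * Vertical boundedness and ultimately constant coefficients *)

Hypothesis Hvb : vertically_bounded le (gammaQL le nu QQ).

(** With [N = size F], boundedness at [g0] with the factor [(N + 1) / N] gives
    [N (q - g0) < (N + 1) (r - g0)]; subtracting [N (r - g0)] yields the claim. The factor matches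
    the slope bound of [nuQ_slope]. *)
Lemma vertical_gap Q0 g0 e0 n0 : QQ_data Q0 g0 e0 n0 ->
  exists R r eR nR, [/\ QQ_data R r eR nR, lt g0 r &
    forall Q q eQ nQ, QQ_data Q q eQ nQ -> lt ((q - r) *+ size F) (r - g0)].
Proof.
move=> d0; have [QQ0 kQ0 _ _ g0G] := d0; set N := size F.
have N0 : (0 < N)%N by rewrite lt0n size_poly_eq0 F_neq0.
have gam Q q eQ nQ : QQ_data Q q eQ nQ -> gammaQL le nu QQ q.
  by case=> QQQ [Qq _ _ _] _ _ qG; split=> //; exists Q; rewrite Qq (leo_refl Hle).
have Nr : (N%:R : rat) != 0 by rewrite Num.Theory.pnatr_eq0 -lt0n.
have q1 : (1 : rat) < N.+1%:R / N%:R.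
  by rewrite Num.Theory.ltr_pdivlMr ?Num.Theory.ltr0n // mul1r Num.Theory.ltr_nat.
have [y [[_ [R [QQR yR]]] hy]] := Hvb (gam _ _ _ _ d0) q1.
have [r [eR [nR dR]]] := QQ_dataP QQR; exists R, r, eR, nR.
have yr : le y r by case: dR => _ [Rr _ _ _] _ _ _; rewrite Rr in yR.
have key Q q eQ nQ : QQ_data Q q eQ nQ -> lt ((q - g0) *+ N) ((r - g0) *+ N.+1).
  move=> /gam/hy h; apply: (@lt_le_tr _ _ Hle ((y - g0) *+ N.+1)); last first.
    by apply: leMn => //; rewrite le_D2r.
  have -> : (y - g0) *+ N.+1 = (N.+1%:R / N%:R : rat) *: (y - g0) *+ N.
    by rewrite -!scaler_nat scalerA mulrC divfK.
  by move: h; rewrite !(ltLNge Hle); apply: contra; apply: leMn_inv.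
split=> // [|Q q eQ nQ /key h].
  have := key _ _ _ _ d0; rewrite subrr mul0rn !(ltLNge Hle); apply: contra => rg.
  have : le (r - g0) 0 by rewrite -(le_D2r Hle g0) subrK add0r.
  by move=> /(leMn Hle N.+1); rewrite mul0rn.
apply: lt_transfer h _ => //.
have -> : q - r = (q - g0) - (r - g0) by rewrite opprB addrA subrK.
by rewrite mulrnBl opprB mulrS addrA.
Qed.

Lemma inB_inBct l : (0 < l)%N -> inB le nu m QQ F l -> inBct le nu m QQ F l.
Proof.
move=> l0 Bl; split=> //.
have [Q0 QQ0] := QQ_nonempty; have [g0 [e0 [n0 d0]]] := QQ_dataP QQ0.
have [R [r [eR [nR [dR g0r gap]]]]] := vertical_gap d0.
have [QQR kR mR sR _] := dR; have [Rr _ _ _] := kR.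
have [wR ewR] := nuQ_finite Hnu Hm kR mR sR F_neq0.
(* The threshold satisfies [E + r *+ l = wR + (r - g0)], which by [bound] exceeds all values
   [nu_Q' F]. *)
pose E := wR - r *+ l + (r - g0).
have bound Q' : QQ Q' -> ~~ geo (wR + (r - g0)) (nuQ Q' F).
  move=> QQ'; have [q [e [n d]]] := QQ_dataP QQ'; have [_ kQ mQ sQ _] := d.
  have [w ew] := nuQ_finite Hnu Hm kQ mQ sQ F_neq0.
  have [Qq _ _ _] := kQ; rewrite ew geoE -(ltLNge Hle).
  have [rq|] := boolP (le r q).
    apply: (le_lt_tr Hle (nuQ_slope dR d rq ewR ew)).
    by rewrite ![wR + _]addrC lt_D2r //; apply: gap d.
  rewrite -(ltLNge Hle) => /lt_le qr.
  have : geo w (nuQ R F).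
    by apply: (nuQ_mono QQ' QQR); rewrite ?Qq ?Rr // ew geoE (leLxx Hle).
  rewrite ewR geoE => /(le_lt_tr Hle); apply.
  by rewrite -{1}[wR]addr0 ![wR + _]addrC lt_D2r // -(lt_D2r Hle g0) add0r subrK.
have stG := stable_mod (stable_lt (size_Rderiv sR l0)).
set G := Rderiv R l in stG.
have [Q3 [QQ3 h3]] := eventually_and stG (eventually_ge QQR).
have err Q : QQ Q -> qleq Q3 Q -> geo E (nu (qcoef Q F l - G %% Q)).
  by move=> QQQ /(h3 _ QQQ)[_ [_ RQ]]; apply: qcoef_Rderiv d0 dR _ ewR QQQ RQ; apply: lt_le.
have modG Q : QQ Q -> qleq Q3 Q -> nu (G %% Q) = nu G by move=> QQQ /(h3 _ QQQ)[].
have split_coef Q : qcoef Q F l = G %% Q + (qcoef Q F l - G %% Q) by rewrite addrC subrK.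
(* If [nu G >= E], both parts of the coefficient are at least [E] for large [Q], so its term lies
   beyond every [nu_Q' F], against membership in [B]. Otherwise [G] dominates the error and fixes
   the value. *)
have [geG|] := boolP (geo E (nu G)).
  have [|Q [c [b [QQQ [RQ Q3Q] Qc Qb [Q' QQ' h]]]]] :=
      @inB_frequently l (fun Q => qleq R Q /\ qleq Q3 Q) Bl.
    exists Q3; split=> // Q QQQ h; split=> //.
    by have [_ []] := h3 _ QQQ h.
  case/negP: (bound _ QQ'); apply: geo_le h => //.
  have : geo E (nu (qcoef Q F l)).
    by rewrite split_coef; apply: (geo_nuD Hle Hnu); rewrite ?modG //; apply: err.
  rewrite Qb geoE /E => Eb; rewrite Rr Qc /= in RQ.
  have := leD Hle Eb (leMn Hle l RQ).
  by rewrite addrAC subrK.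
rewrite -[geo E _]/(leo le (Some E) _).
case eG: (nu G) => [g|] // Eg.
have gE : lt g E by rewrite (ltLNge Hle).
have cst Q : QQ Q -> qleq Q3 Q -> nu (qcoef Q F l) = Some g.
  move=> QQQ hQ; rewrite split_coef; apply: (nuD_eq Hle Hnu); first by rewrite modG.
  by apply: gto_lt (err _ QQQ hQ).
exists Q3; split=> // Q QQQ hQ; rewrite /beta !cst //; exact: leo_refl.
Qed.

End LimitKeyPolynomial.

Theorem mainTheorem7 (K : fieldType) (L : lmodType rat) (le : rel L)
  (Hle : ordered_qspace le)
  (nu : {poly K} -> option L)
  (Hnu : is_poly_valuation le nu)
  (Hws : well_specified le nu)
  (m : nat) (Hm : (0 < m)%N)
  (HPsi_ne : exists Q, Psi le nu m Q)
  (HPsi_nomax : forall Q, Psi le nu m Q ->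
                  exists R, Psi le nu m R /\ lto le (nu Q) (nu R))
  (QQ : {poly K} -> Prop)
  (HQQ : forall Q, QQ Q -> Psi le nu m Q)
  (HQQwo : well_ordered_by_value le nu QQ)
  (HQQcof : cofinal_in_Psi le nu m QQ)
  (Hunst : exists f, ~ stable le nu QQ f)
  (F : {poly K}) (HF : limit_key_poly le nu QQ F)
  (Hvb : vertically_bounded le (gammaQL le nu QQ)) :
  forall l : nat, inB le nu m QQ F l <-> (l = 0%N \/ inBct le nu m QQ F l).
Proof.
move=> l; split=> [Bl|[->|[]//]].
  by case: l Bl => [|l] Bl; [left | right; apply: inB_inBct].
exact: inB0.
Qed.
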